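(* Let $G$ be the infinite 3-regular tree. Then $\textrm{ERR:LD\%}(G) = \frac{3}{4}$.
   Context: $N(v)$ is the open neighborhood of $v$ and $N[v]=N(v)\cup\{v\}$. ERR:LD sets (error-correcting locating-dominating sets): $S \subseteq V(G)$ is a set of detectors. At most one intruder is present, located at some vertex. A correctly working detector $v\in S$ transmits $2$ if the intruder is at $v$, $1$ if the intruder is in $N(v)$, and $0$ otherwise. At most one detector may transmit an incorrect value. $S$ is an ERR:LD set if, from the transmitted values, one can always determine whether an intruder is present and, if so, its exact location. Equivalently: $|N[v] \cap S| \ge 3$ for all $v\in V(G)$, and $|((N(v) \cap S) \triangle (N(u) \cap S)) - \{v,u\}| \ge 3 - |\{v,u\}\cap S|$ for all distinct $u,v\in V(G)$. $\textrm{ERR:LD\%}(G)$ denotes the minimum possible value of the density of an ERR:LD set $S$ for $G$, where the density of $S$ is the proportion of the vertices of $G$ that lie in $S$, formally $\limsup_{r\to\infty} \frac{|B_r(v)\cap S|}{|B_r(v)|}$ for any vertex $v\in V(G)$, with $B_r(v)=\{u\in V(G): d(u,v)\le r\}$. *)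

(* Defs.v *)
From HB Require Import structures.
From mathcomp Require Import all_boot all_order all_algebra finmap.
From mathcomp Require Import all_classical all_reals.
From mathcomp Require Import ereal topology normedtype sequences.

Set Implicit Arguments.
Unset Strict Implicit.
Unset Printing Implicit Defensive.

Import Order.TTheory GRing.Theory Num.Theory.

Local Open Scope classical_set_scope.
Local Open Scope ring_scope.

(* Simple graphs, with a possibly infinite vertex set. *)
Record sgraph := SGraph {
  vertex :> choiceType;
  adj : rel vertex;
  adj_sym : symmetric adj;
  adj_irrefl : irreflexive adj }.

Section Graph.
Variable G : sgraph.
Implicit Types (u v w : G) (S : set G) (x : option G).

Definition open_nbhd v : set G := [set u | adj v u].

Definition regular (k : nat) : Prop := forall v, (open_nbhd v #= `I_k)%card.

Definition walk u v (n : nat) : Prop :=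
  exists p : seq G, [/\ path (@adj G) u p, last u p = v & size p = n].

Definition connected_graph : Prop := forall u v, exists n, walk u v n.

(* [ucycle] also holds of sequences of length at most 2 (a vertex traversed
   zero times, an edge traversed back and forth), which are not graph cycles. *)
Definition acyclic : Prop := forall c : seq G, ucycle (@adj G) c -> (size c < 3)%N.

Definition is_tree : Prop := connected_graph /\ acyclic.

Definition is_dist u v (d : nat) : Prop :=
  walk u v d /\ forall n, walk u v n -> (d <= n)%N.

Definition gball v (r : nat) : set G :=
  [set u | exists2 d, is_dist u v d & (d <= r)%N].

(* The value sent by a correctly working detector at [w]; [x] is the location of
   the intruder, [None] if there is no intruder. *)
Definition signal x w : 'I_3 :=
  if x is Some v then
    if v == w then inord 2 else if adj w v then inord 1 else inord 0
  else inord 0.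

(* [f] can be received when the state is [x]: at most one detector is wrong. *)
Definition possible S x (f : S -> 'I_3) : Prop :=
  forall w1 w2 : S, f w1 <> signal x (val w1) -> f w2 <> signal x (val w2) ->
    w1 = w2.

Definition ERRLD S : Prop :=
  exists locate : (S -> 'I_3) -> option G,
    forall x (f : S -> 'I_3), possible x f -> locate f = x.

Section Density.
Variable R : realType.

(* In a locally finite graph, balls are finite, so [fset_set] does not take its
   default value. *)
Definition density_at S v : \bar R :=
  limn_esup (fun r : nat =>
    ((#|` fset_set (gball v r `&` S)|)%:R / (#|` fset_set (gball v r)|)%:R)%:E).

(* [d] is the minimum density of an ERR:LD set. The value of [density_at S v]
   may depend on [v] in a graph of exponential growth; here [d] is the minimum
   for every choice of the base point, and some set attains it at all of them. *)
Definition is_ERRLD_pct (d : \bar R) : Prop :=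
  (exists2 S, ERRLD S & forall v, density_at S v = d) /\
  (forall S, ERRLD S -> forall v, (d <= density_at S v)%E).

End Density.
End Graph.

(* Main.v *)
(* Let T be the complement of S, b_r the size of the ball of radius r about v and
   t_r the number of its points in T. An ERR:LD set meets each closed neighborhood,
   of size 4, in at least 3 points, so T meets it at most once; summing over the
   ball of radius r + 1 gives t_(r+2) + t_(r+1) + 2 t_r <= b_(r+1), while
   b_(r+2) + b_(r+1) + 2 b_r = 4 b_(r+1). Hence among any three consecutive radii
   one has t_k <= b_k / 4, which bounds the limsup of the density of S from below.
   Conversely, a T meeting each closed neighborhood exactly once can be built
   downwards from a root; its complement is ERR:LD, and the equality
   e_(r+2) + e_(r+1) + 2 e_r = 0 for e_r = 4 t_r - b_r makes e_r grow only like
   sqrt(2)^r, so that the density is 3/4 about every base point. *)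
Require Import Defs.
From mathcomp Require Import all_boot all_order all_algebra finmap.
From mathcomp Require Import zify ring lra.
From mathcomp Require Import all_classical all_reals ereal topology normedtype sequences.

Set Implicit Arguments.
Unset Strict Implicit.
Unset Printing Implicit Defensive.

(** * Uniqueness of paths in an acyclic graph *)

Section Acyclic.
Variable G : sgraph.
Hypothesis G_acyclic : acyclic G.
Implicit Types (u v w x y : G) (p q : seq G).

Lemma adjC u v : adj u v = adj v u.
Proof. exact: adj_sym. Qed.

Lemma adj_neq u v : adj u v -> u != v.
Proof. by apply: contraTneq => ->; rewrite adj_irrefl. Qed.

Lemma chordless_path x p :
  path (@adj G) x p -> uniq (x :: p) -> adj (last x p) x -> size p < 2.
Proof.
move=> xp xpU xpA; have /G_acyclic // : ucycle (@adj G) (x :: p).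
by rewrite /ucycle xpU /= rcons_path xp xpA.
Qed.

Lemma adj_path_rev x p : path (@adj G) x p -> path (@adj G) (last x p) (rev (belast x p)).
Proof.
by rewrite rev_path => xp; rewrite (@eq_path _ _ (@adj G)) // => u v; exact: adjC.
Qed.

(** If the first steps [a] and [b] differ, following [p] to the common end and returning along [q]
    joins [a] to [b] while avoiding [x]. Made repetition-free and closed through [x], this is a
    cycle with at least three vertices. *)
Lemma uniq_path_inj x p q :
    path (@adj G) x p -> path (@adj G) x q -> uniq (x :: p) -> uniq (x :: q) ->
  last x p = last x q -> p = q.
Proof.
elim: p x q => [|a p IHp] x [|b q] //=.
- by move=> _ _ _ /andP[xq _] Dx; rewrite Dx mem_last in xq.
- by move=> _ _ /andP[xp _] _ Dx; rewrite -Dx mem_last in xp.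
case/andP=> xa ap /andP[xb bq] /andP[xNp apU] /andP[xNq bqU] Dl.
have [Dab|Nab] := eqVneq a b.
  by subst b; rewrite (IHp a q).
pose c := p ++ rev (belast b q).
have ac : path (@adj G) a c by rewrite cat_path ap Dl adj_path_rev.
have Dc : last a c = b.
  rewrite last_cat Dl; case: {+}q => [|b' q'] //=.
  by rewrite rev_cons last_rcons.
have xNc : x \notin a :: c.
  rewrite inE mem_cat mem_rev !negb_or.
  move: xNp; rewrite inE negb_or => /andP[-> ->] /=.
  by apply: contra xNq => /mem_belast.
case/shortenP: ac Dc => c' ac' ac'U sub_c' Dc.
have xNc' : x \notin a :: c'.
  by apply: contra xNc; rewrite !inE => /orP[-> //|/sub_c' ->]; rewrite orbT.
have : size (a :: c') < 2.
  apply: (@chordless_path x); first by rewrite /= xa.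
    by rewrite cons_uniq xNc'.
  by rewrite /= Dc adjC.
by case: (c') Dc => //= Dab; rewrite Dab eqxx in Nab.
Qed.

End Acyclic.

(** * Depth and parent in a tree rooted at a given vertex *)

Section Tree.
Variable G : sgraph.
Hypothesis G_tree : is_tree G.
Implicit Types (u v w x y : G) (p q : seq G).
Let G_acyclic : acyclic G := proj2 G_tree.

Lemma geodesic_ex v u :
  exists p, [&& path (@adj G) v p, uniq (v :: p) & last v p == u].
Proof.
have [n [p [vp Dp _]]] := proj1 G_tree v u.
case/shortenP: vp Dp => q vq vqU _ Dq.
by exists q; rewrite vq vqU Dq eqxx.
Qed.

Definition geodesic v u : seq G := xchoose (geodesic_ex v u).
Definition depth v u : nat := size (geodesic v u).
(** This is the last vertex but one on the path from the root [v] to [u]; the root is its own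
    parent. *)
Definition parent v u : G := last v (rev (behead (rev (geodesic v u)))).

Lemma geodesicP v u p :
  path (@adj G) v p -> uniq (v :: p) -> last v p = u -> geodesic v u = p.
Proof.
move=> vp vpU Dp; have /and3P[vq vqU /eqP Dq] := xchooseP (geodesic_ex v u).
by apply: (uniq_path_inj G_acyclic vq vp vqU vpU); rewrite Dq Dp.
Qed.

Lemma depthxx v : depth v v = 0.
Proof. by rewrite /depth (@geodesicP _ _ [::]). Qed.

Lemma depth_eq0 v u : (depth v u == 0) = (u == v).
Proof.
apply/idP/eqP => [|->]; last by rewrite depthxx.
rewrite size_eq0 => /eqP D.
by have /and3P[_ _ /eqP <-] := xchooseP (geodesic_ex v u); rewrite -/(geodesic v u) D.
Qed.

Lemma geodesic_rcons v u w p :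
    path (@adj G) v p -> uniq (v :: p) -> last v p = u -> adj u w ->
    w \notin v :: p ->
  depth v w = (depth v u).+1 /\ parent v w = u.
Proof.
move=> vp vpU Dp uw wNp; rewrite /depth /parent.
rewrite (geodesicP vp vpU Dp) (@geodesicP _ _ (rcons p w)).
- by rewrite size_rcons rev_rcons /= revK.
- by rewrite rcons_path vp Dp.
- by rewrite -rcons_cons rcons_uniq wNp vpU.
- by rewrite last_rcons.
Qed.

(** If [w] is off the path from [v] to [u], that path extends to [w]. If [w] is on it, its initial
    segment up to [w] extends to [u], and by uniqueness this is the whole path. *)
Lemma adj_depth v u w : adj u w ->
  (depth v w = (depth v u).+1 /\ parent v w = u) \/
  (depth v u = (depth v w).+1 /\ parent v u = w).
Proof.
move=> uw; have /and3P[] := xchooseP (geodesic_ex v u).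
rewrite -/(geodesic v u); move: (geodesic v u) => p vp vpU /eqP Dp.
have [wp|wNp] := boolP (w \in v :: p); last by left; apply: geodesic_rcons Dp _ _.
right; case/splitPl: wp vp vpU Dp => p1 p2 Dw.
rewrite cat_path -cat_cons cat_uniq last_cat Dw => /andP[vp1 _].
case/and3P=> vp1U /hasPn p2U _ Dp.
apply: (geodesic_rcons vp1 vp1U Dw); first by rewrite adjC.
(* The remainder [p2] contains its endpoint [u]: if it were empty, [w] would equal [u], giving a
   loop. *)
apply: p2U; rewrite -Dp; case: (p2) Dp => [|a p2'] /=; last by rewrite mem_last.
by move=> Dwu; move: uw; rewrite Dwu adj_irrefl.
Qed.

Lemma parentP v u : u != v ->
  adj u (parent v u) /\ depth v u = (depth v (parent v u)).+1.
Proof.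
move=> uv; have /and3P[] := xchooseP (geodesic_ex v u).
rewrite -/(geodesic v u); move: (geodesic v u) => p.
case/lastP: p => [|p a]; first by move=> _ _ /eqP /= Dv; rewrite Dv eqxx in uv.
rewrite rcons_path last_rcons -rcons_cons rcons_uniq.
case/andP=> vp pa /andP[aNp vpU] /eqP Da; subst a.
have [] := geodesic_rcons vp vpU erefl pa aNp => -> ->.
by rewrite adjC.
Qed.

Lemma walkC u v n : walk u v n -> walk v u n.
Proof.
case=> p [up Dp <-]; exists (rev (belast u p)).
rewrite size_rev size_belast -Dp adj_path_rev //; split=> //.
by case: p {up Dp} => [|a p] //=; rewrite rev_cons last_rcons.
Qed.

(** Removing repetitions from any walk yields the unique path, so no walk is shorter than it. *)
Lemma is_dist_depth v u : is_dist u v (depth v u).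
Proof.
have /and3P[vp _ /eqP Dp] := xchooseP (geodesic_ex v u).
split=> [|n /walkC[q [vq Dq <-]]]; first by apply: walkC; exists (geodesic v u).
case/shortenP: vq Dq => q' vq' q'U sub_q' Dq'.
by rewrite /depth (geodesicP vq' q'U Dq') uniq_leq_size //; case/andP: q'U.
Qed.

Lemma gballE v r : gball v r = [set u | depth v u <= r]%classic.
Proof.
apply/seteqP; split=> u /= => [[d [du d_min] le_dr]|le_ur]; last first.
  by exists (depth v u) => //; apply: is_dist_depth.
have [_ depth_min] := is_dist_depth v u.
by apply: leq_trans _ le_dr; apply: depth_min.
Qed.

End Tree.

(** * Finite balls of the cubic tree and double counting *)

Lemma sum_mem_swap (T : eqType) (s t : seq T) : uniq s -> uniq t ->
  \sum_(x <- s) (x \in t : nat) = \sum_(x <- t) (x \in s : nat).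
Proof.
move=> sU tU; rewrite -!big_mkcond !sum1_count -!size_filter.
apply: perm_size; apply: uniq_perm; rewrite ?filter_uniq // => x.
by rewrite !mem_filter andbC.
Qed.

Section CubicTree.
Variable G : sgraph.
Hypothesis G_tree : is_tree G.
Hypothesis G_cubic : regular G 3.
Implicit Types (u v w x y : G) (p q : seq G).
Local Notation depth := (depth G_tree).
Local Notation parent := (parent G_tree).

Definition nbhs_seq v : seq G := fset_set (open_nbhd v).
Definition closed_nbhd v : seq G := v :: nbhs_seq v.

Lemma mem_nbhs_seq v u : (u \in nbhs_seq v) = adj v u.
Proof.
rewrite /nbhs_seq in_fset_set; last by apply/finite_setP; exists 3.
by apply/idP/idP; rewrite inE.
Qed.

Lemma size_nbhs_seq v : size (nbhs_seq v) = 3.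
Proof. exact: card_fset_set (G_cubic v). Qed.

Lemma mem_closed_nbhd v u : (u \in closed_nbhd v) = (u == v) || adj v u.
Proof. by rewrite inE mem_nbhs_seq. Qed.

Lemma closed_nbhdC v u : (u \in closed_nbhd v) = (v \in closed_nbhd u).
Proof. by rewrite !mem_closed_nbhd adjC eq_sym. Qed.

Lemma closed_nbhd_uniq v : uniq (closed_nbhd v).
Proof. by rewrite /= mem_nbhs_seq adj_irrefl fset_uniq. Qed.

Lemma size_closed_nbhd v : size (closed_nbhd v) = 4.
Proof. by rewrite /= size_nbhs_seq. Qed.

(** Every vertex of the ball other than the center is adjacent to its parent, which lies in the ball
    of the previous radius. *)
Lemma finite_gball v r : finite_set (gball v r).
Proof.
elim: r => [|r IHr].
  apply: (@sub_finite_set _ _ [set v]%classic); last exact: finite_set1.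
  by rewrite (gballE G_tree) => u /=; rewrite leqn0 depth_eq0 => /eqP.
apply: (@sub_finite_set _ _ (\bigcup_(w in gball v r) [set` closed_nbhd w])%classic).
  rewrite !(gballE G_tree) => u /= le_dr.
  have [->|uv] := eqVneq u v.
    by exists v; rewrite /= ?mem_head // depthxx.
  have [upu dpu] := parentP G_tree uv.
  exists (parent v u); first by rewrite /= -ltnS -dpu.
  by rewrite /= mem_closed_nbhd adjC upu orbT.
by apply: bigcup_finite => // w _; apply: finite_seq.
Qed.

Definition disk v r : seq G := fset_set (gball v r).

Lemma mem_disk v r u : (u \in disk v r) = (depth v u <= r).
Proof.
rewrite /disk in_fset_set; last exact: finite_gball.
by rewrite (gballE G_tree); apply/idP/idP; rewrite inE.
Qed.

Lemma disk_uniq v r : uniq (disk v r).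
Proof. exact: fset_uniq. Qed.

Definition disk_sum (f : G -> nat) v r : nat := \sum_(u <- disk v r) f u.

Lemma disk_sum_restrict f v r k : k <= r ->
  \sum_(w <- disk v r) (depth v w <= k) * f w = disk_sum f v k.
Proof.
move=> le_kr; rewrite /disk_sum.
under eq_bigr => w _ do rewrite mulnbl -[if _ then _ else _]/(if _ then f w else 0).
rewrite -big_mkcond -big_filter; apply: perm_big.
apply: uniq_perm; rewrite ?filter_uniq ?disk_uniq // => w.
rewrite mem_filter !mem_disk andb_idr // => le_wk; exact: leq_trans le_wk le_kr.
Qed.

(** Away from the root [v], the neighbors of [w] are its parent, one level closer to [v], and two
    vertices one level farther. *)
Lemma closed_nbhd_depth v w r :
  \sum_(u <- closed_nbhd w) (depth v u <= r.+1 : nat) =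
  (depth v w <= r.+2) + (depth v w <= r.+1) + 2 * (depth v w <= r).
Proof.
have sum_const (s : seq G) (b : bool) :
    (forall u, u \in s -> (depth v u <= r.+1) = b) ->
    \sum_(u <- s) (depth v u <= r.+1 : nat) = size s * b.
  move=> sb; rewrite (eq_big_seq (fun=> b : nat)) => [|u /sb -> //].
  by rewrite big_const_seq count_predT iter_addn addn0 mulnC.
rewrite big_cons.
(* At the root all four vertices have depth at most 1, so both sides are 4 for every [r]. *)
have [->|wv] := eqVneq w v.
  rewrite depthxx (sum_const _ true) ?size_nbhs_seq // => u.
  rewrite mem_nbhs_seq => /(adj_depth G_tree v).
  by rewrite depthxx => -[] [//] ->.
have [wpw dpw] := parentP G_tree wv.
have pw_nbhs : parent v w \in nbhs_seq w by rewrite mem_nbhs_seq.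
rewrite (perm_big _ (perm_to_rem pw_nbhs)) big_cons /=.
rewrite (sum_const _ (depth v w <= r)) => [|u].
  by rewrite size_rem // size_nbhs_seq dpw !ltnS addnCA addnA.
rewrite mem_rem_uniq ?fset_uniq // inE mem_nbhs_seq => /andP[u_pw /(adj_depth G_tree v)].
by case=> -[Du Dpu]; [rewrite Du | rewrite -Dpu eqxx in u_pw].
Qed.

(* Double counting: a vertex at distance at most r from v lies in 4 of the
   closed neighborhoods centred in the ball of radius r + 1; one at distance
   r + 1 lies in 2 of them (its own and its parent's) and one at distance r + 2
   in 1 of them. *)
Lemma disk_sum_closed_nbhd f v r :
  \sum_(u <- disk v r.+1) \sum_(w <- closed_nbhd u) f w =
  disk_sum f v r.+2 + disk_sum f v r.+1 + 2 * disk_sum f v r.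
Proof.
have sub u : u \in disk v r.+1 -> \sum_(w <- closed_nbhd u) f w =
    \sum_(w <- disk v r.+2) (w \in closed_nbhd u) * f w.
  rewrite mem_disk => le_ur.
  under [RHS]eq_bigr => w _ do
    rewrite mulnbl -[if _ then _ else _]/(if _ then f w else 0).
  rewrite -[RHS]big_mkcond -[RHS]big_filter; apply: perm_big.
  apply: uniq_perm; rewrite ?filter_uniq ?disk_uniq ?closed_nbhd_uniq // => w.
  rewrite mem_filter mem_disk andb_idr // mem_closed_nbhd => /orP[/eqP->|uw].
    by rewrite leqW.
  by case: (adj_depth G_tree v uw) => -[]; lia.
rewrite (eq_big_seq _ sub) exchange_big /=.
transitivity (\sum_(w <- disk v r.+2) ((depth v w <= r.+2) + (depth v w <= r.+1)
    + 2 * (depth v w <= r)) * f w).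
  apply: eq_bigr => w _; rewrite -big_distrl /= -closed_nbhd_depth; congr (_ * _).
  under eq_bigr => u _ do rewrite closed_nbhdC.
  rewrite sum_mem_swap ?disk_uniq ?closed_nbhd_uniq //.
  by apply: eq_bigr => u _; rewrite mem_disk.
under eq_bigr => w _ do rewrite 2!mulnDl -mulnA.
rewrite !big_split big1_eq /= !disk_sum_restrict; lia.
Qed.

End CubicTree.

(** * Detector signals and ERR:LD sets *)

Lemma count_le1P (T : eqType) (P : pred T) (s : seq T) : uniq s ->
  (forall x y, x \in s -> y \in s -> P x -> P y -> x = y) -> count P s <= 1.
Proof.
move=> sU P_inj; rewrite -size_filter leqNgt; apply/negP => gt1.
have: uniq [seq z <- s | P z] by apply: filter_uniq.
have mem_s x : x \in [seq z <- s | P z] -> x \in s /\ P x by rewrite mem_filter => /andP[].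
case: [seq z <- s | P z] gt1 mem_s => [|x [|y t]] //= _ mem_s.
have [|xs Px] := mem_s x; first exact: mem_head.
have [|ys Py] := mem_s y; first by rewrite !inE eqxx orbT.
by rewrite (P_inj x y) // mem_head.
Qed.

Lemma size_filterD (T : Type) (P : pred T) (s : seq T) :
  size [seq x <- s | P x] + count (fun x => ~~ P x) s = size s.
Proof. by rewrite size_filter -(count_predC P). Qed.

Section Signal.
Variable G : sgraph.
Implicit Types (u v w : G) (S : set G) (x y : option G).

Lemma val_signal v w : signal (Some v) w = (if v == w then 2 else adj w v) :> nat.
Proof. by rewrite /signal; case: ifP => _; last case: ifP => _; rewrite inordK. Qed.

Lemma val_signal_None w : signal None w = 0 :> nat.
Proof. by rewrite /signal inordK. Qed.

(** If the same received values were possible for [x] and for [y], each of three separating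
    detectors would be wrong for one of these states, hence two of them wrong for the same state. *)
Lemma ERRLD_separated S :
  (forall x y, x <> y -> exists q, [/\ uniq q, 3 <= size q &
     forall w, w \in q -> w \in S /\ signal x w <> signal y w]) ->
  ERRLD S.
Proof.
move=> sepS; exists (fun f => xget None [set x | possible x f]%classic) => x f xf.
apply: xget_unique => //= y yf; apply: contrapT => /sepS.
case=> -[|a [|b [|c q]]] [] //= /andP[+ /andP[+ _]] _ sep.
rewrite !inE !negb_or => /and3P[ab ac _] /andP[bc _].
have lift w : w \in [:: a, b, c & q] -> exists2 w' : S, val w' = w &
    f w' <> signal x w \/ f w' <> signal y w.
  move=> /sep[wS xyw]; exists (exist _ w wS) => //=.
  have [Dx|] := eqVneq (f (exist _ w wS)) (signal x w); last by left; apply/eqP.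
  by right=> Dy; apply: xyw; rewrite -Dx -Dy.
have [|a' Da fa] := lift a; first by rewrite mem_head.
have [|b' Db fb] := lift b; first by rewrite !inE eqxx orbT.
have [|c' Dc fc] := lift c; first by rewrite !inE eqxx !orbT.
subst a b c.
(* Pigeonhole: in each of the eight cases two of the three detectors err for the same state. *)
case: fa fb fc => fa [] fb [] fc;
  first [ have D := xf _ _ fa fb | have D := xf _ _ fa fc | have D := xf _ _ fb fc
        | have D := yf _ _ fa fb | have D := yf _ _ fa fc | have D := yf _ _ fb fc ];
  by rewrite D eqxx in ab ac bc.
Qed.

End Signal.

Section CubicTree.
Variable G : sgraph.
Hypothesis G_tree : is_tree G.
Hypothesis G_cubic : regular G 3.
Implicit Types (u v w x y : G) (S : set G).

(* If two non-detectors lie in N[v], at most two detectors tell an intruder at v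
   from no intruder; a wrong value at one of them makes the two states confusable. *)
Lemma ERRLD_count S v : ERRLD S -> count (fun u => u \notin S) (closed_nbhd v) <= 1.
Proof.
case=> locate locateP; rewrite leqNgt; apply/negP => ge2.
pose q := [seq u <- closed_nbhd v | u \in S].
have size_q : size q <= 2.
  have := size_filterD (fun u => u \in S) (closed_nbhd v).
  by rewrite size_closed_nbhd // -/q; lia.
(* If [q] is empty, the default [v] is not a detector, so no value is falsified. *)
pose c := head v q.
pose f (w : S) := if val w == c then signal None (val w) else signal (Some v) (val w).
suff [fv f0] : possible (Some v) f /\ possible None f.
  by have := locateP _ _ fv; rewrite (locateP _ _ f0).
split=> w1 w2; rewrite /f.
  by case: eqP => // D1 _; case: eqP => // D2 _; apply: val_inj; rewrite D1 D2.
have wrong (w : S) : val w != c -> signal (Some v) (val w) <> signal None (val w) ->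
    val w \in q.
  move=> _ Nw; rewrite mem_filter (valP w) mem_closed_nbhd //; apply: contraT => Nvw; exfalso.
  apply: Nw; apply: ord_inj; rewrite val_signal val_signal_None.
  by rewrite adjC eq_sym; case/norP: Nvw => /negPf -> /negPf ->.
case: eqP => // /eqP N1 /(wrong _ N1) q1; case: eqP => // /eqP N2 /(wrong _ N2) q2.
apply: val_inj; move: N1 N2 q1 q2; rewrite /c.
case: (q) size_q => [|a [|b [|]]] //= _ /negPf N1 /negPf N2; rewrite !inE N1 N2 //.
by move=> /eqP -> /eqP ->.
Qed.

(** Seen from [u], both [v] and [w] have depth 1, whereas depths of adjacent vertices differ by
    one. *)
Lemma no_triangle u v w : adj u v -> adj u w -> ~~ adj v w.
Proof.
move=> uv uw; apply/negP => /(adj_depth G_tree u).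
have D x : adj u x -> depth G_tree u x = 1.
  by case/(adj_depth G_tree u) => -[]; rewrite depthxx.
by rewrite !D // => -[] [].
Qed.

(** In the tree rooted at [u], a common neighbor of [u] and [v] has depth 1, so it must be the
    parent of [v]. *)
Lemma common_nbr_uniq u v w1 w2 : u != v ->
  adj u w1 -> adj u w2 -> adj v w1 -> adj v w2 -> w1 = w2.
Proof.
move=> uv u1 u2 v1 v2.
have D x : adj u x -> depth G_tree u x = 1.
  by case/(adj_depth G_tree u) => -[]; rewrite depthxx.
have P x : adj u x -> adj v x -> parent G_tree u v = x.
  move=> ux vx; case: (adj_depth G_tree u vx) => -[] //.
  rewrite D // => -[/esym/eqP]; rewrite depth_eq0 => /eqP Dv.
  by rewrite Dv eqxx in uv.
by rewrite -(P w1) // -(P w2).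
Qed.

Lemma ERRLD_perfect S :
  (forall v, count (fun u => u \notin S) (closed_nbhd v) = 1) -> ERRLD S.
Proof.
move=> S1; pose s v := [seq u <- closed_nbhd v | u \in S].
have size_s v : size (s v) = 3.
  have := size_filterD (fun u => u \in S) (closed_nbhd v).
  by rewrite size_closed_nbhd // S1 -/(s v); lia.
have sU v : uniq (s v) by rewrite filter_uniq ?closed_nbhd_uniq.
have mem_s v w : w \in s v = (w \in S) && ((w == v) || adj v w).
  by rewrite mem_filter mem_closed_nbhd.
have sepN v w : w \in s v -> w \in S /\ signal (Some v) w <> signal None w.
  rewrite mem_s => /andP[-> vw]; split=> // /(congr1 (@nat_of_ord 3)).
  rewrite val_signal val_signal_None adjC eq_sym.
  by case: eqP vw => //= _ ->.
have sep u v w : w \in s u -> w \notin closed_nbhd v ->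
    w \in S /\ signal (Some u) w <> signal (Some v) w.
  rewrite mem_closed_nbhd // => /sepN[-> Nw] wv; split=> // Dw; apply: Nw.
  rewrite Dw; apply: ord_inj; rewrite val_signal val_signal_None adjC eq_sym.
  by case/norP: wv => /negPf -> /negPf ->.
apply: ERRLD_separated => -[u|] [v|] // uv; first last.
- exists (s v); rewrite sU size_s; split=> // w /sepN[-> Nw]; split=> // /esym.
  exact: Nw.
- by exists (s u); rewrite sU size_s; split=> // w /sepN[].
have {}uv : u != v by apply/eqP => Duv; apply: uv; rewrite Duv.
(* For adjacent [u] and [v] the three detectors in [N[u]] suffice: when the intruder moves from [u]
   to [v], the signal at [u] goes from 2 to 1, at [v] from 1 to 2 and, without triangles, at the
   other neighbors of [u] from 1 to 0. *)
have [auv|Nauv] := boolP (adj u v).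
  exists (s u); rewrite sU size_s; split=> // w.
  rewrite mem_s => /andP[-> uw]; split=> // /(congr1 (@nat_of_ord 3)).
  rewrite !val_signal.
  case/predU1P: uw => [->|uw]; first by rewrite eqxx eq_sym (negPf uv) auv.
  rewrite (negPf (adj_neq uw)) adjC uw.
  by case: eqP => // _; rewrite adjC (negPf (no_triangle auv uw)).
(* For nonadjacent vertices, [N[u]] and [N[v]] share at most one vertex, so each has at least two
   detectors outside the other: four in all. *)
pose d u v := [seq w <- s u | w \notin closed_nbhd v].
have size_d a b : a != b -> ~~ adj a b -> 2 <= size (d a b).
  move=> ab Nab; have := size_filterD (fun w => w \notin closed_nbhd b) (s a).
  rewrite size_s -/(d a b) (eq_count (a2 := mem (closed_nbhd b))); last first.
    by move=> w /=; rewrite negbK.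
  have : count (mem (closed_nbhd b)) (s a) <= 1.
    apply: count_le1P => // x y; rewrite !mem_s => /andP[_ ax] /andP[_ ay].
    rewrite !inE /= !mem_nbhs_seq // => bx by_.
    have common z : (z == a) || adj a z -> (z == b) || adj b z -> adj a z /\ adj b z.
      case/predU1P=> [->|az]; first by rewrite (negPf ab) adjC (negPf Nab).
      by case/predU1P=> // Dz; rewrite -Dz az in Nab.
    have [ax' bx'] := common _ ax bx; have [ay' by'] := common _ ay by_.
    exact: common_nbr_uniq ab ax' ay' bx' by'.
  by move=> le1 E; have := leq_add (leqnn (size (d a b))) le1; rewrite E addn1.
exists (d u v ++ d v u); split.
- rewrite cat_uniq ![uniq (d _ _)]filter_uniq ?sU // andbT /=; apply/hasPn => w.
  rewrite !mem_filter => /andP[wu _]; rewrite negb_and; apply/orP; right.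
  by rewrite (negPf wu) andbF.
- rewrite size_cat; have := size_d u v uv Nauv.
  have := size_d v u; rewrite eq_sym adjC => /(_ uv Nauv); lia.
move=> w; rewrite mem_cat !mem_filter => /orP[] /andP[wN /andP[wS ws]].
  by apply: sep => //; rewrite mem_filter wS.
have sw : w \in s v by rewrite mem_filter wS.
have [_ Nw] := sep v u w sw wN; by split=> // /esym.
Qed.

End CubicTree.

(** * Construction of a perfect code from the root downwards *)

Lemma count_eq1P (T : eqType) (P : pred T) (s : seq T) x : uniq s ->
  x \in s -> P x -> (forall y, y \in s -> P y -> y = x) -> count P s = 1.
Proof.
move=> sU xs Px P_x; apply/eqP; rewrite eqn_leq -has_count.
rewrite count_le1P => // [|y z ys zs Py Pz]; last by rewrite (P_x y) // (P_x z).
by apply/hasP; exists x.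
Qed.

(* [FarFromCode]: neither the vertex nor its parent is in the code, so exactly one
   of its children has to be. *)
Variant code_state := InCode | BelowCode | FarFromCode.

Definition in_code s := if s is InCode then true else false.

(** The rule is designed so that the only code vertex in the closed neighborhood of a vertex is
    itself, its parent or its selected child, according to its state. *)
Definition child_state s (selected : bool) : code_state :=
  match s with
  | InCode => BelowCode
  | BelowCode => FarFromCode
  | FarFromCode => if selected then InCode else FarFromCode
  end.

Section PerfectCode.
Variable G : sgraph.
Hypothesis G_tree : is_tree G.
Hypothesis G_cubic : regular G 3.
Variable o : G.
Implicit Types (u v w x y : G).
Local Notation depth := (depth G_tree o).
Local Notation parent := (parent G_tree o).

Definition children u := [seq w <- nbhs_seq u | depth w == (depth u).+1].

Lemma mem_children u w : w \in children u -> [/\ adj u w, w != o & parent w = u].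
Proof.
rewrite mem_filter mem_nbhs_seq // => /andP[/eqP Dw uw].
have [[_ Dp]|[Du _]] := adj_depth G_tree o uw; last by move: Dw; rewrite Du; lia.
by split=> //; rewrite -(depth_eq0 G_tree) Dw.
Qed.

Lemma nbr_cases u w : adj u w -> w \in children u \/ (u != o /\ w = parent u).
Proof.
move=> uw; have [[Dw _]|[Du Dp]] := adj_depth G_tree o uw.
  by left; rewrite mem_filter Dw eqxx mem_nbhs_seq.
by right; rewrite -(depth_eq0 G_tree) Du.
Qed.

Definition selected_child u : G := head u (children u).

(** Only the parent can be a neighbor that is not a child, so at least two of the three neighbors
    are children and the default of [head] is never reached. *)
Lemma selected_childP u : selected_child u \in children u.
Proof.
have : count (fun w => depth w != (depth u).+1) (nbhs_seq u) <= 1.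
  apply: count_le1P => [|x y]; first exact: fset_uniq.
  rewrite !mem_nbhs_seq // => ux uy /negPf Nx /negPf Ny.
  have P z : adj u z -> (depth z == (depth u).+1) = false -> z = parent u.
    by case/nbr_cases => [|[]//]; rewrite mem_filter => /andP[->].
  by rewrite (P x ux Nx) (P y uy Ny).
have := size_filterD (fun w => depth w == (depth u).+1) (nbhs_seq u).
rewrite size_nbhs_seq // -/(children u) /selected_child.
by case: (children u) => [|a s _ _]; [rewrite add0n => -> | apply: mem_head].
Qed.

(** The recursion climbs along parents but is structural in [n]; called with [n] equal to the depth
    of [u], it stops exactly at the root. *)
Fixpoint state_at n u : code_state :=
  if n is m.+1 then
    child_state (state_at m (parent u)) (u == selected_child (parent u))
  else InCode.

Definition state u := state_at (depth u) u.

Lemma state_root : state o = InCode.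
Proof. by rewrite /state depthxx. Qed.

Lemma stateE u : u != o ->
  state u = child_state (state (parent u)) (u == selected_child (parent u)).
Proof. by move=> uo; rewrite /state (parentP G_tree uo).2. Qed.

Lemma perfect_code u : count (in_code \o state) (closed_nbhd u) = 1.
Proof.
have u_cn : u \in closed_nbhd u by rewrite mem_head.
have cnU := closed_nbhd_uniq G_cubic u.
have child_st w : w \in children u -> state w = child_state (state u) (w == selected_child u).
  by case/mem_children => _ wo Dp; rewrite stateE // Dp.
have cn_cases w : w \in closed_nbhd u ->
    [\/ w = u, w \in children u | u != o /\ w = parent u].
  rewrite mem_closed_nbhd // => /predU1P[->|/nbr_cases[]]; first exact: Or31.
    exact: Or32.
  exact: Or33.
case Du : (state u).
- apply: (@count_eq1P _ _ _ u) => //=; first by rewrite Du.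
  move=> w /cn_cases[//|/child_st|[uo ->]].
    by rewrite Du /= => ->.
  (* A code vertex other than the root has a parent in state [FarFromCode]. *)
  by move: Du; rewrite (stateE uo); case: (state _).
- have uo : u != o by apply/eqP => Duo; rewrite Duo state_root in Du.
  have [upu _] := parentP G_tree uo.
  apply: (@count_eq1P _ _ _ (parent u)) => //=.
  + by rewrite mem_closed_nbhd // upu orbT.
  + by move: Du; rewrite (stateE uo); case: (state _) => //=; case: ifP.
  move=> w /cn_cases[->|/child_st|[_ ->//]]; first by rewrite Du.
  by rewrite Du /= => ->.
have sel_child := selected_childP u.
apply: (@count_eq1P _ _ _ (selected_child u)) => //=.
- by rewrite mem_closed_nbhd //; case/mem_children: sel_child => ->; rewrite orbT.
- by rewrite child_st // Du /= eqxx.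
move=> w /cn_cases[->|/child_st|[uo ->]]; first by rewrite Du.
  by rewrite Du /= => ->; case: eqP.
by move: Du; rewrite (stateE uo); case: (state _).
Qed.

End PerfectCode.

(** * Growth of balls and counting recurrences *)

Section Growth.
Variable G : sgraph.
Hypothesis G_tree : is_tree G.
Hypothesis G_cubic : regular G 3.
Implicit Types (u v : G) (S : set G).

Lemma disk_sum1 v r : disk_sum (fun=> 1) v r = size (disk v r).
Proof. by rewrite /disk_sum sum1_size. Qed.

(** This is the double count of the constant 1, every closed neighborhood having four vertices. *)
Lemma size_disk_rec v r :
  size (disk v r.+2) + 2 * size (disk v r) = 3 * size (disk v r.+1).
Proof.
have := disk_sum_closed_nbhd G_tree G_cubic (fun=> 1) v r.
under eq_bigr => u _ do rewrite sum1_size size_closed_nbhd //.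
rewrite big_const_seq count_predT iter_addn !disk_sum1; lia.
Qed.

(** With b_r the ball sizes, 2 b_r <= b_(r+1) turns b_(r+2) = 3 b_(r+1) - 2 b_r into b_(r+2) >= 2
    b_(r+1). *)
Lemma size_disk_double v r : 2 * size (disk v r) <= size (disk v r.+1).
Proof.
elim: r => [|r IHr]; last by have := size_disk_rec v r; lia.
have b0 : size (disk v 0) <= size [:: v].
  apply: uniq_leq_size (disk_uniq _ _) _ => u.
  by rewrite (mem_disk G_tree) // leqn0 depth_eq0 inE.
have b1 : size (closed_nbhd v) <= size (disk v 1).
  apply: uniq_leq_size (closed_nbhd_uniq G_cubic v) _ => u.
  rewrite (mem_disk G_tree) // mem_closed_nbhd // => /predU1P[->|].
    by rewrite depthxx.
  by case/(adj_depth G_tree v) => -[]; rewrite depthxx // => ->.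
by move: b0 b1; rewrite size_closed_nbhd //=; lia.
Qed.

Lemma size_disk_gt0 v r : 0 < size (disk v r).
Proof.
suff : v \in disk v r by case: (disk v r).
by rewrite (mem_disk G_tree) // depthxx.
Qed.

Lemma size_disk_ge v r : 2 ^ r <= size (disk v r).
Proof.
elim: r => [|r IHr]; first exact: size_disk_gt0.
by rewrite expnS (leq_trans _ (size_disk_double v r)) // leq_mul2l.
Qed.

Lemma card_diskI S v r : #|` fset_set (gball v r `&` S)%classic| =
  disk_sum (fun u => u \in S) v r.
Proof.
rewrite /disk_sum -big_mkcond sum1_count -size_filter.
apply: perm_size; apply: uniq_perm; rewrite ?filter_uniq ?fset_uniq // => u.
have finB := finite_gball G_tree G_cubic v r.
rewrite mem_filter /disk !in_fset_set //; last exact: finite_setIl.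
by rewrite in_setI andbC.
Qed.

Lemma disk_sumC S v r : disk_sum (fun u => u \in S) v r +
  disk_sum (fun u => u \notin S) v r = size (disk v r).
Proof.
rewrite -disk_sum1 -big_split; apply: eq_bigr => u _ /=.
by case: (u \in S).
Qed.

Lemma packing_rec S v r :
    (forall u, count (fun w => w \notin S) (closed_nbhd u) <= 1) ->
  disk_sum (fun u => u \notin S) v r.+2 + disk_sum (fun u => u \notin S) v r.+1
    + 2 * disk_sum (fun u => u \notin S) v r <= size (disk v r.+1).
Proof.
move=> S1; rewrite -(disk_sum_closed_nbhd G_tree G_cubic) -sum1_size.
by apply: leq_sum => u _; rewrite -big_mkcond sum1_count.
Qed.

Lemma perfect_rec S v r :
    (forall u, count (fun w => w \notin S) (closed_nbhd u) = 1) ->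
  disk_sum (fun u => u \notin S) v r.+2 + disk_sum (fun u => u \notin S) v r.+1
    + 2 * disk_sum (fun u => u \notin S) v r = size (disk v r.+1).
Proof.
move=> S1; rewrite -(disk_sum_closed_nbhd G_tree G_cubic) -sum1_size.
by apply: eq_bigr => u _; rewrite -big_mkcond sum1_count.
Qed.

End Growth.

(** * Upper densities: the lower bound and its attainment *)

Import Order.TTheory GRing.Theory Num.Theory numFieldNormedType.Exports.

Local Open Scope ring_scope.

(* The form x^2 + x y + 2 y^2 at (e (r + 1), e r) doubles when r increases,
   while the balls below grow at least like 2^r, i.e. like the square of e. *)
Lemma sqr_le_of_rec (R : realDomainType) (e : nat -> R) :
  (forall r, e r.+2 + e r.+1 + 2 * e r = 0) ->
  forall r, e r ^+ 2 <= (e 1%N ^+ 2 + e 1%N * e 0%N + 2 * e 0%N ^+ 2) * 2 ^+ r.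
Proof.
move=> eS r; pose q r := e r.+1 ^+ 2 + e r.+1 * e r + 2 * e r ^+ 2.
have qS k : q k.+1 = q k * 2.
  by rewrite /q (_ : e k.+2 = - e k.+1 - 2 * e k); [ring | have := eS k; lra].
have qE k : q k = q 0%N * 2 ^+ k.
  by elim: k => [|k IHk]; rewrite ?mulr1 // qS IHk exprSr mulrA.
(* The difference [q r - e r ^+ 2] is x^2 + x y + y^2 at (e (r + 1), e r), which is nonnegative. *)
rewrite -/(q 0%N) -qE /q; nra.
Qed.

Section Density.
Local Open Scope classical_set_scope.
Variables (R : realType) (G : sgraph).
Hypothesis G_tree : is_tree G.
Hypothesis G_cubic : regular G 3.
Implicit Types (u v : G) (S : set G).

Lemma density_ge S v :
    (forall u, (count (fun w => w \notin S) (closed_nbhd u) <= 1)%N) ->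
  ((3 / 4 : R)%:E <= density_at R S v)%E.
Proof.
(* The upper limit is an infimum of suprema over sets [V] containing all radii from some [n] on, so
   one good radius [k] beyond [n] is enough. *)
move=> S1; apply: le_ereal_inf_tmp => _ [V [n _ Vn] <-].
suff [k nk le_k] : exists2 k, (n <= k)%N &
    (3 * size (disk v k) <= 4 * disk_sum (fun u => u \in S) v k)%N.
  apply: (@le_trans _ _ ((#|` fset_set (gball v k `&` S)|)%:R
      / (#|` fset_set (gball v k)|)%:R)%:E); last first.
    by apply: ereal_sup_ubound; exists k => //; apply: Vn.
  rewrite lee_fin (card_diskI G_tree G_cubic) -/(disk v k).
  rewrite ler_pdivlMr ?ltr0n ?size_disk_gt0 //.
  by move: le_k; rewrite -(ler_nat R) !natrM; lra.
have Sk k := disk_sumC S v k.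
have := packing_rec G_tree G_cubic v n S1; have := size_disk_rec G_tree G_cubic v n.
move: (Sk n) (Sk n.+1) (Sk n.+2).
set s0 := disk_sum _ v n; set s1 := disk_sum _ v n.+1; set s2 := disk_sum _ v n.+2.
have [le0|gt0] := leqP (3 * size (disk v n)) (4 * s0); first by exists n.
have [le1|gt1] := leqP (3 * size (disk v n.+1)) (4 * s1); first by exists n.+1.
have [le2|gt2] := leqP (3 * size (disk v n.+2)) (4 * s2).
  by exists n.+2; rewrite // leqW.
(* If all three radii failed, the non-detectors would exceed a quarter of each ball, and the weights
   1, 1, 2 would contradict the packing inequality. *)
lia.
Qed.

Lemma density_perfect S v :
    (forall u, count (fun w => w \notin S) (closed_nbhd u) = 1%N) ->
  density_at R S v = (3 / 4 : R)%:E.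
Proof.
move=> S1; pose b r : R := (size (disk v r))%:R.
pose t r : R := (disk_sum (fun u => u \notin S) v r)%:R.
have b_gt0 r : 0 < b r by rewrite ltr0n size_disk_gt0.
pose e r := 4 * t r - b r.
have eS r : e r.+2 + e r.+1 + 2 * e r = 0.
  have := size_disk_rec G_tree G_cubic v r; have := perfect_rec G_tree G_cubic v r S1.
  rewrite !mulSn !mul0n !addn0 => /(congr1 (fun n => n%:R : R)) + /(congr1 (fun n => n%:R : R)).
  rewrite !natrD -/(b r) -/(b r.+1) -/(b r.+2) -/(t r) -/(t r.+1) -/(t r.+2).
  by rewrite /e; lra.
have densE r : (#|` fset_set (gball v r `&` S)|)%:R / (#|` fset_set (gball v r)|)%:R
    = 3 / 4 - e r / (4 * b r).
  rewrite (card_diskI G_tree G_cubic) -/(disk v r) -/(b r).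
  have := disk_sumC S v r => /(congr1 (fun n => n%:R : R)).
  rewrite natrD -/(b r) -/(t r) /e => Db.
  have -> : t r = b r - (disk_sum (fun u => u \in S) v r)%:R by rewrite -Db; ring.
  by field; apply: lt0r_neq0 (b_gt0 r).
have [C e_le] : exists C, forall r, e r ^+ 2 <= C * 2 ^+ r.
  by eexists; apply: sqr_le_of_rec.
have cvg_dens : (fun r => (3 / 4 - e r / (4 * b r))%:E) @ \oo --> (3 / 4 : R)%:E.
  apply: cvg_EFin; first exact: nearW.
  apply/cvgrPdist_lt => eps eps_gt0; near=> r.
  rewrite /= opprB addrC subrK normrM normfV (gtr0_norm (mulr_gt0 _ (b_gt0 r))) //.
  rewrite ltr_pdivrMr ?mulr_gt0 //.
  (* This threshold suffices, since r <= 2^r <= b_r gives e_r^2 <= C 2^r < eps^2 r 2^r <= (eps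
     b_r)^2. *)
  have Cr : C / eps ^+ 2 < r%:R by near: r; exact: nbhs_infty_gtr.
  rewrite ltr_pdivrMr ?exprn_gt0 // in Cr.
  have two_b : 2 ^+ r <= b r by rewrite -natrX ler_nat size_disk_ge.
  have r_two : r%:R <= 2 ^+ r :> R by rewrite -natrX ler_nat ltnW // ltn_expl.
  rewrite -(ltr_pXn2r (n := 2)) ?nnegrE ?normr_ge0 ?mulr_ge0 ?ltW //.
  rewrite real_normK ?num_real //; apply: le_lt_trans (e_le r) _.
  have two_gt0 : 0 < 2 ^+ r :> R by rewrite exprn_gt0.
  have step1 : C * 2 ^+ r < (r%:R * eps ^+ 2) * 2 ^+ r by rewrite ltr_pM2r.
  have step2 : r%:R * 2 ^+ r <= b r * b r.
    by rewrite ler_pM ?ler0n ?(ltW two_gt0) // (le_trans r_two).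
  have : eps ^+ 2 * (r%:R * 2 ^+ r) <= eps ^+ 2 * (b r * b r).
    by rewrite ler_pM2l ?exprn_gt0.
  have : 0 < eps ^+ 2 * (b r * b r) by rewrite !mulr_gt0.
  by move: step1; rewrite !expr2; nra.
have -> : density_at R S v = limn_esup (fun r => (3 / 4 - e r / (4 * b r))%:E).
  by rewrite /density_at; congr limn_esup; apply/funext => r; rewrite densE.
by rewrite is_cvg_limn_esupE; [apply/cvg_lim | apply/cvg_ex; eexists; exact: cvg_dens].
Unshelve. all: by end_near.
Qed.

End Density.

Theorem theorem4p2 (R : realType) (G : sgraph)
    (G_infinite : infinite_set [set: G]%classic)
    (G_tree : is_tree G) (G_cubic : regular G 3) :
  is_ERRLD_pct G ((3 / 4 : R)%:E).
Proof.
split=> [|S ES v]; last by apply: density_ge => // u; apply: ERRLD_count.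
(* An infinite graph has a vertex [o], the root of the code whose complement is the optimal set. *)
have [o _] : ([set: G] !=set0)%classic.
  by apply/set0P/negP => /eqP G0; apply: G_infinite; rewrite G0.
pose S : set G := [set u | ~~ in_code (state G_tree o u)]%classic.
have S1 u : count (fun w => w \notin S) (closed_nbhd u) = 1%N.
  rewrite -(perfect_code G_tree G_cubic o u); apply: eq_count => w /=.
  have -> : (w \in S) = ~~ in_code (state G_tree o w) by apply/idP/idP; rewrite inE.
  exact: negbK.
by exists S => [|v]; [apply: ERRLD_perfect | apply: density_perfect].
Qed.
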